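(* Let $\lambda$ be a nonzero real number. For every positive integer $n$, the degenerate harmonic number $H_{n,\lambda}$ satisfies $$H_{n,\lambda}=\sum_{k=1}^{n}\frac{(-\lambda)^{k-1}(1)_{k,1/\lambda}}{k!}.$$
   Context: All generating functions are formal power series in $t$ with real coefficients. For real $\mu$ and $x$: $(x)_{0,\mu}=1$, $(x)_{k,\mu}=x(x-\mu)\cdots(x-(k-1)\mu)$ for $k\ge1$; thus $(1)_{k,1/\lambda}=\prod_{j=0}^{k-1}(1-j/\lambda)$. The degenerate logarithm is $\log_\lambda(1+t)=\frac{1}{\lambda}\left((1+t)^\lambda-1\right)$. The degenerate harmonic numbers $H_{n,\lambda}$ ($n\ge1$) are defined by $-\frac{\log_\lambda(1-t)}{1-t}=\sum_{n\ge1}H_{n,\lambda}t^n$. *)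

(* Defs.v *)
From mathcomp Require Import all_boot all_order all_algebra.
From mathcomp Require Import reals.

Set Implicit Arguments.
Unset Strict Implicit.
Unset Printing Implicit Defensive.

Import Order.TTheory GRing.Theory Num.Theory.
Local Open Scope ring_scope.

(* A formal power series is its coefficient sequence, [f n] being the          *)
(* coefficient of t^n. No pointwise ring structure on functions is used: the   *)
(* product [fps_mul] is the Cauchy product.                                    *)
Definition fps (R : Type) : Type := nat -> R.

Section FormalPowerSeries.
Variable R : fieldType.
Implicit Types f g : fps R.

Definition fps_one : fps R := fun n => (n == 0%N)%:R.
Definition fps_X : fps R := fun n => (n == 1%N)%:R.
Definition fps_opp f : fps R := fun n => - f n.
Definition fps_sub f g : fps R := fun n => f n - g n.
Definition fps_scale (c : R) f : fps R := fun n => c * f n.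
Definition fps_mul f g : fps R := fun n => \sum_(i < n.+1) f i * g (n - i)%N.

(* f(c t) *)
Definition fps_subst_scale (c : R) f : fps R := fun n => c ^+ n * f n.

(* The first n+1 coefficients of 1/f, from the recursion                       *)
(*   g_0 = 1/f_0,  g_(m+1) = - (1/f_0) * \sum_(i <= m) f_(i+1) g_(m-i).        *)
Fixpoint fps_inv_seq f (n : nat) : seq R :=
  if n is m.+1 then
    let s := fps_inv_seq f m in
    rcons s (- (f 0%N)^-1 * \sum_(i < m.+1) f i.+1 * s`_(m - i))
  else [:: (f 0%N)^-1].

(* Multiplicative inverse, meaningful when f 0 != 0 (see [fps_mulV]). *)
Definition fps_inv f : fps R := fun n => (fps_inv_seq f n)`_n.

Definition fps_div f g : fps R := fps_mul f (fps_inv g).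

Lemma size_fps_inv_seq f n : size (fps_inv_seq f n) = n.+1.
Proof. by elim: n => //= n IHn; rewrite size_rcons IHn. Qed.

Lemma nth_fps_inv_seq f n m : (m <= n)%N -> (fps_inv_seq f n)`_m = fps_inv f m.
Proof.
elim: n => [|n IHn]; first by rewrite leqn0 => /eqP->.
rewrite leq_eqVlt => /predU1P[-> //|lt_mn].
by rewrite /= nth_rcons size_fps_inv_seq lt_mn IHn.
Qed.

Lemma fps_mulV f : f 0%N != 0 -> fps_mul f (fps_inv f) =1 fps_one.
Proof.
move=> f0 [|n]; rewrite /fps_mul big_ord_recl /= ?big_ord0 ?addr0.
  by rewrite /fps_inv /= divff.
rewrite subn0 {1}/fps_inv /= nth_rcons size_fps_inv_seq ltnn eqxx.
rewrite mulrA mulrN divff // mulN1r addrC; apply/eqP; rewrite subr_eq0.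
by apply/eqP/eq_bigr => i _; rewrite nth_fps_inv_seq ?leq_subr // subSS.
Qed.

End FormalPowerSeries.

Arguments fps_one {R}.
Arguments fps_X {R}.

Section DegenerateHarmonic.
Variable R : realType.
Implicit Types x mu lambda : R.

(* (x)_{k,mu} = x (x - mu) ... (x - (k-1) mu) *)
Definition degenerate_falling x mu (k : nat) : R :=
  \prod_(j < k) (x - j%:R * mu).

(* (1 + t)^a as the binomial series; (a)_{k,1} is the usual falling factorial. *)
Definition binomial_series (a : R) : fps R :=
  fun k => degenerate_falling a 1 k / k`!%:R.

(* log_lambda(1 + t) *)
Definition degenerate_log lambda : fps R :=
  fps_scale lambda^-1 (fps_sub (binomial_series lambda) fps_one).

(* - log_lambda(1 - t) / (1 - t); log_lambda(1 - t) is log_lambda(1 + t) with  *)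
(* t replaced by -t.                                                           *)
Definition degenerate_harmonic_gf lambda : fps R :=
  fps_div (fps_opp (fps_subst_scale (-1) (degenerate_log lambda)))
          (fps_sub fps_one fps_X).

(* Only n >= 1 is relevant; the coefficient of t^0 vanishes                    *)
(* ([degenerate_harmonic0]), as the expansion starting at n = 1 requires.      *)
Definition degenerate_harmonic (n : nat) lambda : R :=
  degenerate_harmonic_gf lambda n.

Lemma degenerate_harmonic0 lambda : degenerate_harmonic 0 lambda = 0.
Proof.
rewrite /degenerate_harmonic /degenerate_harmonic_gf /fps_div /fps_mul.
rewrite big_ord1 /fps_opp /fps_subst_scale /degenerate_log /fps_scale /fps_sub.
rewrite /binomial_series /degenerate_falling /fps_one big_ord0 fact0.
by rewrite divr1 subrr !mulr0 oppr0 mul0r.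
Qed.

End DegenerateHarmonic.

(* Main.v *)
(** Since 1/(1 - t) has all its coefficients equal to 1, H_{n,lambda} is the sum
    of the first coefficients of - log_lambda(1 - t); these are the summands
    because lambda^k (1)_{k,1/lambda} is the falling factorial
    lambda (lambda - 1) ... (lambda - k + 1). *)
Require Import Defs.
From mathcomp Require Import all_boot all_order all_algebra.
From mathcomp Require Import reals.

Import Order.TTheory GRing.Theory Num.Theory.
Local Open Scope ring_scope.

(** In (1 - t) g = 1 the coefficient of t^(n+1) reads g_(n+1) - g_n = 0, since only the first two
    terms of the Cauchy product survive. *)
Lemma fps_inv_1subX (R : fieldType) (n : nat) :
  fps_inv (fps_sub fps_one fps_X : fps R) n = 1.
Proof.
set f := fps_sub _ _.
have f0 : f 0%N = 1 by rewrite /f /fps_sub /fps_one /fps_X subr0.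
have f0_neq0 : f 0%N != 0 by rewrite f0 oner_eq0.
elim: n => [|n IHn]; first by rewrite /fps_inv /= f0 invr1.
have := fps_mulV f0_neq0 n.+1.
rewrite /fps_mul 2!big_ord_recl big1 => [|i _]; last first.
  by rewrite /f /fps_sub /fps_one /fps_X /= subrr mul0r.
have f1 : f (lift ord0 (ord0 : 'I_n.+1)) = -1.
  by rewrite /f /fps_sub /fps_one /fps_X sub0r.
rewrite f0 f1 subn0 subSS subn0 IHn.
by rewrite mul1r mulr1 addr0 => /eqP; rewrite subr_eq0 => /eqP.
Qed.

Lemma fps_div_1subX (R : fieldType) (f : fps R) (n : nat) :
  fps_div f (fps_sub fps_one fps_X) n = \sum_(0 <= k < n.+1) f k.
Proof.
rewrite big_mkord; apply: eq_bigr => i _.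
by rewrite fps_inv_1subX mulr1.
Qed.

(** Each of the k factors contributes one c. *)
Lemma degenerate_falling_scale (R : realType) (c x mu : R) (k : nat) :
  degenerate_falling (c * x) (c * mu) k = c ^+ k * degenerate_falling x mu k.
Proof.
rewrite /degenerate_falling -[k in c ^+ k]card_ord -prodr_const -big_split /=.
by apply: eq_bigr => j _; rewrite mulrBr mulrCA.
Qed.

Theorem mainTheorem6 (R : realType) (lambda : R) (hlambda : lambda != 0)
    (n : nat) (hn : (0 < n)%N) :
  degenerate_harmonic n lambda =
    \sum_(1 <= k < n.+1)
      (- lambda) ^+ (k - 1)%N * degenerate_falling 1 (1 / lambda) k / k`!%:R.
Proof.
rewrite /degenerate_harmonic /degenerate_harmonic_gf fps_div_1subX.
(* The partial sum starts at k = 0; the case n = 0 is exactly that extra term, so it vanishes. *)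
have := degenerate_harmonic0 lambda.
rewrite /degenerate_harmonic /degenerate_harmonic_gf fps_div_1subX big_nat1.
rewrite big_add1 big_nat_recl // => ->; rewrite add0r.
apply: eq_bigr => k _; rewrite subn1 /=.
rewrite /fps_opp /fps_subst_scale /degenerate_log /fps_scale /fps_sub.
rewrite /binomial_series /fps_one /= subr0.
have -> : degenerate_falling lambda 1 k.+1 =
    lambda ^+ k.+1 * degenerate_falling 1 (1 / lambda) k.+1.
  by rewrite -degenerate_falling_scale mulr1 mul1r divff.
(* The outer sign absorbs one -1 of (-1)^(k+1), and lambda^-1 one factor of lambda^(k+1), leaving (-
   lambda)^k. *)
rewrite exprS mulN1r mulNr opprK [(- lambda) ^+ k]exprNn exprS !mulrA.
by rewrite mulfVK.
Qed.
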